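(* For any connected graph $G$ with no isolated vertex and of minimum degree $\delta$, $$\gamma_{oitR}(G)\leq 2\alpha(G)+\gamma(G)-\delta+1.$$
   Context: All graphs are finite, undirected and simple (no loops or multiple edges). $\alpha(G)$ is the vertex cover number: the minimum cardinality of a set of vertices such that every edge of $G$ is incident to at least one vertex of the set. $\gamma(G)$ is the domination number: the minimum cardinality of a set $D\subseteq V(G)$ such that every vertex in $V(G)\setminus D$ has a neighbor in $D$. For a graph $G$ with no isolated vertex and a function $f:V(G)\to\{0,1,2\}$, let $V_i=\{v\in V(G): f(v)=i\}$ for $i\in\{0,1,2\}$. The function $f$ is an outer-independent total Roman dominating function on $G$ if (i) every vertex in $V_0$ is adjacent to at least one vertex in $V_2$; (ii) $V_0$ is an independent set; and (iii) the subgraph induced by $V_1\cup V_2$ has no isolated vertex. The outer-independent total Roman domination number $\gamma_{oitR}(G)$ is the minimum weight $\omega(f)=\sum_{v\in V(G)}f(v)$ among all such functions. *)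

(* Defs.v *)
From mathcomp Require Import all_boot all_order all_algebra.

Set Implicit Arguments.
Unset Strict Implicit.
Unset Printing Implicit Defensive.

(* A graph is a relation [e] on a finite type of vertices, assumed symmetric
   and irreflexive. *)
Section Graphs.

Variables (T : finType) (e : rel T).

Definition simple_graph : Prop := symmetric e /\ irreflexive e.

Definition connected_graph : Prop :=
  0 < #|T| /\ forall x y : T, connect e x y.

Definition no_isolated_vertex : Prop := forall x : T, exists y : T, e x y.

Definition degree (x : T) : nat := #|[set y | e x y]|.

(* In a simple graph every degree is less than #|T|, so the default value #|T|
   does not affect the minimum when T is nonempty. *)
Definition min_degree : nat := \big[minn/#|T|]_(x : T) degree x.

Definition vertex_cover (S : {set T}) : bool :=
  [forall x, forall y, e x y ==> (x \in S) || (y \in S)].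

Definition vertex_cover_number : nat :=
  #|[arg min_(S < [set: T] | vertex_cover S) #|S|]|.

Definition dominating (D : {set T}) : bool :=
  [forall x in ~: D, exists y in D, e x y].

Definition domination_number : nat :=
  #|[arg min_(D < [set: T] | dominating D) #|D|]|.

Definition independent (A : {set T}) : bool :=
  [forall x in A, forall y in A, ~~ e x y].

Definition level (f : {ffun T -> 'I_3}) (i : nat) : {set T} :=
  [set v | f v == i :> nat].

Definition weight (f : {ffun T -> 'I_3}) : nat := \sum_(v : T) f v.

Definition oitRDF (f : {ffun T -> 'I_3}) : bool :=
  let V12 := level f 1 :|: level f 2 in
  [&& [forall v in level f 0, exists w in level f 2, e v w],
      independent (level f 0)
    & [forall v in V12, exists w in V12, e v w]].

(* The constant function 1 satisfies [oitRDF] as soon as the graph has no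
   isolated vertex, the only case in which the minimum is meaningful. *)
Definition oitR_domination_number : nat :=
  weight [arg min_(f < [ffun=> inord 1] | oitRDF f) weight f].

End Graphs.

(* Main.v *)
Require Import Defs.
From mathcomp Require Import all_boot all_order all_algebra.
From mathcomp Require Import zify.

Set Implicit Arguments.
Unset Strict Implicit.
Unset Printing Implicit Defensive.

Import Order.TTheory GRing.Theory Num.Theory.
Local Open Scope ring_scope.

(** Let [S] be a minimum vertex cover, [D] a minimum dominating set and [A] a
    set of [delta - 1] vertices of [S]. Put weight 2 on [S :\: A], 1 on [A],
    and 1 on those vertices outside [S] which lie in [D] or were chosen as a
    neighbour of some vertex of [D :&: S]; the latter cost at most [#|D|].
    A vertex outside [S] has at least [delta] neighbours, all in [S], hence one
    of weight 2. A vertex of [S] has a positive neighbour: the chosen one if it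
    is in [D], and otherwise one in [D]. *)

Section Bound.

Local Open Scope nat_scope.

Variables (T : finType) (e : rel T).

Lemma min_degree_le (x : T) : min_degree e <= degree e x.
Proof.
rewrite /min_degree; elim: (index_enum T) (mem_index_enum x) => //= y s IHs.
rewrite inE big_cons => /predU1P[-> | /IHs le_x]; first exact: geq_minl.
exact: leq_trans (geq_minr _ _) le_x.
Qed.

Lemma coverP (S : {set T}) (x y : T) :
  vertex_cover e S -> e x y -> x \notin S -> y \in S.
Proof.
by move=> /forallP/(_ x)/forallP/(_ y)/implyP covS /covS/orP[->|].
Qed.

(** A vertex outside [S] has its whole neighbourhood in [S]. If there is none, [S] is everything and
    the default [#|T|] caps the minimum. *)
Lemma min_degree_le_cover (S : {set T}) :
  vertex_cover e S -> min_degree e <= #|S|.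
Proof.
move=> covS; have [SC0 | [x]] := set_0Vmem (~: S).
  have ->: #|S| = #|T| by rewrite -[S]setCK SC0 setC0 cardsT.
  rewrite /min_degree; elim/big_rec: _ => // y m _ le_m.
  exact: leq_trans (geq_minr _ _) le_m.
rewrite inE => xNS; apply: leq_trans (min_degree_le x) (subset_leq_card _).
by apply/subsetP=> y; rewrite inE => /(coverP covS); apply.
Qed.

Lemma oitRDF_of_cover_dominating (S D A : {set T}) :
    symmetric e -> no_isolated_vertex e ->
    vertex_cover e S -> dominating e D -> A \subset S ->
    #|A| < min_degree e ->
  exists2 f, oitRDF e f & weight f + #|A| <= 2 * #|S| + #|D|.
Proof.
move=> e_sym noisol covS domD sAS ltA.
pose nb x := odflt x [pick y | e x y].
have e_nb x : e x (nb x).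
  rewrite /nb; case: pickP => //= no_y.
  by have [y] := noisol x; rewrite no_y.
(* Since [E] is an image of [D], the vertices outside [S] that receive weight 1 number at most
   [#|D|]. *)
pose h x := if x \in S then nb x else x.
pose E := h @: D.
(* The last indicator vanishes on [S] and the first two vanish off it, so the sum is at most 2 and
   [inord] keeps it. *)
pose f := [ffun v => inord (n' := 2)
  ((v \in S) + (v \in S :\: A) + (v \in E :\: S))].
have fE v : f v = (v \in S) + (v \in S :\: A) + (v \in E :\: S) :> nat.
  by rewrite ffunE inordK // !inE; case: (v \in S) (v \in A) (v \in E) => [] [] [].
have V0 v : (v \in level f 0) = (v \notin S) && (v \notin E).
  by rewrite inE fE !inE; case: (v \in S) (v \in A) (v \in E) => [] [] [].
have V2 v : (v \in level f 2) = (v \in S :\: A).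
  by rewrite inE fE !inE; case: (v \in S) (v \in A) (v \in E) => [] [] [].
have V12 v : (v \in level f 1 :|: level f 2) = (v \in S) || (v \in E).
  by rewrite !inE fE !inE; case: (v \in S) (v \in A) (v \in E) => [] [] [].
exists f; last first.
  have ->: weight f = #|S| + #|S :\: A| + #|E :\: S|.
    rewrite /weight (eq_bigr _ (fun v _ => fE v)) !big_split /=.
    by rewrite -!big_mkcond !sum1_card.
  have leE : #|E :\: S| <= #|D|.
    exact: leq_trans (subset_leq_card (subsetDl _ _)) (leq_imset_card _ _).
  have := cardsID A S; rewrite (setIidPr sAS); lia.
apply/and3P; split.
- apply/forall_inP=> v; rewrite V0 => /andP[vNS _].
  (* [A] has fewer than [min_degree e] elements, too few to contain all neighbours of [v]. *)
  have /subsetPn[w] : ~~ ([set y | e v y] \subset A).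
    apply: contraL ltA => /subset_leq_card leA.
    by rewrite -leqNgt (leq_trans (min_degree_le v)).
  rewrite inE => evw wNA; apply/exists_inP; exists w => //.
  by rewrite V2 inE wNA (coverP covS evw).
- apply/forall_inP=> v; rewrite V0 => /andP[vNS _].
  apply/forall_inP=> w; rewrite V0 => /andP[wNS _].
  by apply: contra wNS => /(coverP covS); apply.
apply/forall_inP=> v; rewrite V12 => posv; apply/exists_inP.
have [vS | vNS] := boolP (v \in S); last first.
  by exists (nb v) => //; rewrite V12 (coverP covS (e_nb v)).
have [vD | vND] := boolP (v \in D).
  exists (nb v) => //; rewrite V12; apply/orP; right.
  by apply/imsetP; exists v; rewrite // /h vS.
(* The dominating neighbour [u] is positive: either it lies in [S], or [h u = u] puts it in [E]. *)
have /exists_inP[u uD evu] : [exists u in D, e v u].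
  by apply: (forall_inP domD); rewrite inE.
exists u => //; rewrite V12; have [//|uNS /=] := boolP (u \in S).
by apply/imsetP; exists u; rewrite // /h (negPf uNS).
Qed.

(** This makes the default of the minimum admissible, as [arg_minnP] requires. *)
Lemma oitRDF_const1 :
  no_isolated_vertex e -> oitRDF e [ffun=> inord 1].
Proof.
move=> noisol; have lev i v : (v \in level [ffun=> inord 1] i) = (i == 1).
  by rewrite inE ffunE inordK // eq_sym.
apply/and3P; split.
- by apply/forall_inP=> v; rewrite lev.
- by apply/forall_inP=> v; rewrite lev.
apply/forall_inP=> v _; have [w evw] := noisol v.
by apply/exists_inP; exists w => //; rewrite inE lev.
Qed.

Lemma oitR_domination_number_le (f : {ffun T -> 'I_3}) :
  no_isolated_vertex e -> oitRDF e f ->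
  oitR_domination_number e <= weight f.
Proof.
move=> noisol oitf; rewrite /oitR_domination_number.
by case: arg_minnP => [|g _]; [exact: oitRDF_const1 | apply].
Qed.

Lemma min_degree_gt0 :
  0 < #|T| -> no_isolated_vertex e -> 0 < min_degree e.
Proof.
move=> T_gt0 noisol; rewrite /min_degree; elim/big_ind: _ => // [m n|x _].
  by rewrite leq_min => -> ->.
by have [y exy] := noisol x; apply/card_gt0P; exists y; rewrite inE.
Qed.

End Bound.

Theorem theorem2p11 (T : finType) (e : rel T)
  (e_simple : simple_graph e) (e_connected : connected_graph e)
  (e_noisol : no_isolated_vertex e) :
  (oitR_domination_number e)%:Z <=
    2 * (vertex_cover_number e)%:Z + (domination_number e)%:Z
      - (min_degree e)%:Z + 1.
Proof.
have [e_sym _] := e_simple; have [T_gt0 _] := e_connected.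
rewrite /vertex_cover_number /domination_number.
case: arg_minnP => [|S covS _].
  by apply/forallP=> x; apply/forallP=> y; rewrite !inE implybT.
case: arg_minnP => [|D domD _].
  by apply/forall_inP=> x; rewrite !inE.
(* Positivity makes the predecessor below a true subtraction: a set of [min_degree e - 1] vertices
   is strictly smaller than [min_degree e], and the missing unit is the final [+ 1] of the bound. *)
have delta_gt0 := min_degree_gt0 T_gt0 e_noisol.
have /card_geqP[s [s_uniq size_s sS]] : ((min_degree e).-1 <= #|S|)%N.
  exact: leq_trans (leq_pred _) (min_degree_le_cover covS).
have cardA : #|[set:: s]| = (min_degree e).-1.
  by rewrite cardsE (card_uniqP s_uniq).
have sAS : [set:: s] \subset S by apply/subsetP=> x; rewrite inE => /sS.
have ltA : (#|[set:: s]| < min_degree e)%N by rewrite cardA prednK.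
have [f oitf wf] := oitRDF_of_cover_dominating e_sym e_noisol covS domD sAS ltA.
have := oitR_domination_number_le e_noisol oitf.
lia.
Qed.
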